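(* The following is a classification, up to inner automorphism, of the $1$-dimensional Lie subalgebras of $\mathfrak{so}(4,\mathbb{C})$: $$J^1=\langle x_1\rangle,\quad J^2=\langle x_2\rangle,\quad J^3=\langle h_1\rangle,\quad J^4=\langle h_2\rangle,\quad J^5=\langle x_1+x_2\rangle,$$ $$J^6=\langle x_1+h_2\rangle,\quad J^7=\langle h_1+x_2\rangle,\quad J^{8,a}=\langle h_1+a h_2\rangle\ \ (a\in\mathbb{C}^* ),$$ where, for $a,b\in\mathbb{C}^*$, $J^{8,a}\sim J^{8,b}$ if and only if $a=\pm b$. That is: every $1$-dimensional subalgebra of $\mathfrak{so}(4,\mathbb{C})$ is equivalent to one of the subalgebras listed, and the only equivalences between distinct members of the list are $J^{8,a}\sim J^{8,-a}$.
   Context: $\mathfrak{so}(4,\mathbb{C})\cong\mathfrak{sl}(2,\mathbb{C})\oplus\mathfrak{sl}(2,\mathbb{C})$ is realized as the Lie algebra of $4\times4$ complex block diagonal matrices with two traceless $2\times 2$ diagonal blocks. With $E_{ij}$ the $4\times 4$ matrix units, its Chevalley basis is $x_1=E_{12}$, $y_1=E_{21}$, $h_1=E_{11}-E_{22}$, $x_2=E_{34}$, $y_2=E_{43}$, $h_2=E_{33}-E_{44}$. The notation $\langle\cdots\rangle$ denotes complex linear span, and $\mathbb{C}^*=\mathbb{C}\setminus\{0\}$. The inner automorphisms of $\mathfrak{so}(4,\mathbb{C})$ are the maps $X\mapsto AXA^{-1}$ with $A\in SL(2,\mathbb{C})\times SL(2,\mathbb{C})$ (block diagonal $4\times4$ matrices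 with both $2\times2$ blocks of determinant $1$). Two subalgebras $S,S'$ are equivalent (up to inner automorphism), written $S\sim S'$, if $\psi(S)=S'$ for some inner automorphism $\psi$ of $\mathfrak{so}(4,\mathbb{C})$. *)

(* Defs.v *)
From HB Require Import structures.
From mathcomp Require Import all_boot all_order all_algebra.
From mathcomp Require Import reals complex.

Set Implicit Arguments.
Unset Strict Implicit.
Unset Printing Implicit Defensive.

Import GRing.Theory.
Local Open Scope ring_scope.

(* Everything is written over a field F; the intended instance is R[i] with
   R : realType, i.e. the complex numbers. *)

Definition in_so4 (F : fieldType) (X : 'M[F]_4) : Prop :=
  exists P Q : 'M[F]_2,
    [/\ X = block_mx P 0 0 Q :> 'M[F]_(2 + 2), \tr P = 0 & \tr Q = 0].

(* Entries are indexed from 0, so E_{ij} is delta_mx (i - 1) (j - 1). *)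
Definition x1 (F : fieldType) : 'M[F]_4 := delta_mx 0 1.
Definition h1 (F : fieldType) : 'M[F]_4 := delta_mx 0 0 - delta_mx 1 1.
Definition x2 (F : fieldType) : 'M[F]_4 := delta_mx 2 3.
Definition h2 (F : fieldType) : 'M[F]_4 := delta_mx 2 2 - delta_mx 3 3.

Definition lie_bracket (F : fieldType) (X Y : 'M[F]_4) : 'M[F]_4 :=
  X *m Y - Y *m X.

Definition so4_subalgebra (F : fieldType) (S : {vspace 'M[F]_4}) : Prop :=
  (forall X, X \in S -> in_so4 X) /\
  (forall X Y, X \in S -> Y \in S -> lie_bracket X Y \in S).

Definition in_SL2xSL2 (F : fieldType) (A : 'M[F]_4) : Prop :=
  exists P Q : 'M[F]_2,
    [/\ A = block_mx P 0 0 Q :> 'M[F]_(2 + 2), \det P = 1 & \det Q = 1].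

Definition inner_aut (F : fieldType) (A X : 'M[F]_4) : 'M[F]_4 :=
  A *m X *m invmx A.

Fact inner_aut_is_linear (F : fieldType) (A : 'M[F]_4) :
  linear (inner_aut A).
Proof.
by move=> a X Y; rewrite /inner_aut mulmxDr mulmxDl -scalemxAr -scalemxAl.
Qed.

HB.instance Definition _ (F : fieldType) (A : 'M[F]_4) :=
  GRing.isLinear.Build F 'M[F]_4 'M[F]_4 *:%R (inner_aut A)
    (inner_aut_is_linear A).

Definition inner_equiv (F : fieldType) (S S' : {vspace 'M[F]_4}) : Prop :=
  exists2 A : 'M[F]_4, in_SL2xSL2 A & (linfun (inner_aut A) @: S)%VS = S'.

Inductive label (F : fieldType) : Type :=
  L1 | L2 | L3 | L4 | L5 | L6 | L7 | L8 of F.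

Arguments L1 {F}.
Arguments L2 {F}.
Arguments L3 {F}.
Arguments L4 {F}.
Arguments L5 {F}.
Arguments L6 {F}.
Arguments L7 {F}.
Arguments L8 {F} a.

(* The parameter of the eighth family is required to be nonzero. *)
Definition admissible (F : fieldType) (l : label F) : bool :=
  if l is L8 a then a != 0 else true.

Definition J (F : fieldType) (l : label F) : {vspace 'M[F]_4} :=
  match l with
  | L1 => <[ x1 F ]>
  | L2 => <[ x2 F ]>
  | L3 => <[ h1 F ]>
  | L4 => <[ h2 F ]>
  | L5 => <[ x1 F + x2 F ]>
  | L6 => <[ x1 F + h2 F ]>
  | L7 => <[ h1 F + x2 F ]>
  | L8 a => <[ h1 F + a *: h2 F ]>
  end%VS.

(* Main.v *)
Require Import Defs.
From mathcomp Require Import all_boot all_order all_algebra.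
From mathcomp Require Import reals complex.
From mathcomp Require Import ring.

(**
A traceless 2x2 matrix over an algebraically closed field is conjugate under
SL(2) to 0, to any nonzero multiple of E_{12}, or to a nonzero multiple of
diag(1,-1). Lines in so(4) spanned by pairs (P, Q) and (P', Q') are equivalent
iff, for a common c != 0, P is conjugate to c P' and Q to c Q'. Only in the
semisimple-semisimple case does the common scalar matter, and it leaves the
parameter a. The vanishing of P, Q, det P, det Q separates the eight families,
and the determinants force a^2 = b^2 in the eighth one; the sign is realized by
the Weyl group element of one factor.
*)

Set Implicit Arguments.
Unset Strict Implicit.
Unset Printing Implicit Defensive.

Import GRing.Theory.
Local Open Scope ring_scope.

(** * Entrywise calculus of 2x2 matrices *)

Section Matrix2.
Variable R : comNzRingType.

Definition mx2 (a b c d : R) : 'M[R]_2 :=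
  \matrix_(i, j) if i == 0 then (if j == 0 then a else b)
                 else (if j == 0 then c else d).

Lemma ord2P (i : 'I_2) : i = 0 \/ i = 1.
Proof. by case: i => [[|[|//]] lti]; [left | right]; apply: val_inj. Qed.

Lemma mx2_eta (M : 'M[R]_2) : M = mx2 (M 0 0) (M 0 1) (M 1 0) (M 1 1).
Proof.
by apply/matrixP => i j; rewrite mxE;
  case: (ord2P i) => ->; case: (ord2P j) => ->.
Qed.

Lemma mul_mx2 a b c d a' b' c' d' :
  mx2 a b c d *m mx2 a' b' c' d' =
  mx2 (a * a' + b * c') (a * b' + b * d') (c * a' + d * c') (c * b' + d * d').
Proof.
apply/matrixP => i j; rewrite !mxE !big_ord_recl big_ord0 !mxE /= addr0.
by case: (ord2P i) => ->; case: (ord2P j) => ->.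
Qed.

Lemma scale_mx2 k a b c d :
  k *: mx2 a b c d = mx2 (k * a) (k * b) (k * c) (k * d).
Proof. by apply/matrixP => i j; rewrite !mxE; do 2 case: ifP. Qed.

Lemma mx2_eq0 a b c d :
  (mx2 a b c d == 0) = [&& a == 0, b == 0, c == 0 & d == 0].
Proof.
apply/eqP/and4P => [/matrixP M0|[/eqP-> /eqP-> /eqP-> /eqP->]].
  by have := (M0 0 0, M0 0 1, M0 1 0, M0 1 1);
    rewrite !mxE /= => -[[[-> ->] ->] ->].
by apply/matrixP => i j; rewrite !mxE; do 2 case: ifP.
Qed.

Lemma det_mx2 a b c d : \det (mx2 a b c d) = a * d - b * c.
Proof.
rewrite (expand_det_row _ 0) !big_ord_recl big_ord0 /cofactor !det_mx11 !mxE /=.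
by rewrite addr0 expr0 expr1 mul1r mulN1r mulrN.
Qed.

Lemma tr_mx2 a b c d : \tr (mx2 a b c d) = a + d.
Proof. by rewrite /mxtrace !big_ord_recl big_ord0 !mxE /= addr0. Qed.

End Matrix2.

(** * Conjugacy of 2x2 matrices under SL(2) *)

Section Conjugacy2.
Variable F : fieldType.

(** Stated as an intertwining relation to avoid inverses; [g] is invertible since its determinant is
    1. *)
Definition sl2_conj (P Q : 'M[F]_2) : Prop :=
  exists2 g : 'M[F]_2, \det g = 1 & g *m P = Q *m g.

Definition nil2 : 'M[F]_2 := mx2 0 1 0 0.
Definition diag2 : 'M[F]_2 := mx2 1 0 0 (-1).

Lemma sl2_conj_refl P : sl2_conj P P.
Proof. by exists 1%:M; rewrite ?det1 // mul1mx mulmx1. Qed.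

Lemma sl2_conj_trans P Q T : sl2_conj P Q -> sl2_conj Q T -> sl2_conj P T.
Proof.
move=> [g detg gP] [k detk kQ]; exists (k *m g).
  by rewrite det_mulmx detg detk mulr1.
by rewrite -mulmxA gP mulmxA kQ mulmxA.
Qed.

Lemma sl2_conj_det P Q : sl2_conj P Q -> \det P = \det Q.
Proof.
by move=> [g detg /(congr1 determinant)]; rewrite !det_mulmx detg mul1r mulr1.
Qed.

Lemma sl2_conj_eq0 P Q : sl2_conj P Q -> (P == 0) = (Q == 0).
Proof.
move=> [g detg gP]; have ug : g \in unitmx by rewrite unitmxE detg unitr1.
apply/eqP/eqP => Z0; move: gP; rewrite Z0 ?(mulmx0, mul0mx).
  by move=> /(congr1 (mulmxr (invmx g))); rewrite /= mul0mx mulmxK.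
by move=> /(congr1 (mulmx (invmx g))); rewrite mulmx0 mulKmx.
Qed.

Lemma sl2_conj_diagN c : sl2_conj (c *: diag2) (- c *: diag2).
Proof.
exists (mx2 0 1 (-1) 0); first by rewrite det_mx2; ring.
by rewrite !scale_mx2 !mul_mx2; congr mx2; ring.
Qed.

(** Completes [v] to an element of SL(2) with rows [(a, b)] and [v]. *)
Lemma unimodular_row (v : 'rV[F]_2) :
  v != 0 -> exists a b, a * v 0 1 - b * v 0 0 = 1.
Proof.
move=> v0; have [v1|v1] := eqVneq (v 0 1) 0; last first.
  by exists (v 0 1)^-1, 0; rewrite mulVf // mul0r subr0.
exists 0, (- (v 0 0)^-1); rewrite mul0r sub0r mulNr opprK mulVf //.
apply: contra v0 => /eqP v00; apply/eqP/rowP => i.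
by rewrite mxE; case: (ord2P i) => ->.
Qed.

End Conjugacy2.

(** Triangularize, then diagonalize if the eigenvalues differ, or rescale by the torus if both
    vanish. In the nilpotent case [c] is left free, so that it can later match the scalar of the
    other block. *)
Lemma sl2_normal_form (F : numClosedFieldType) (P : 'M[F]_2) : \tr P = 0 ->
  [\/ P = 0,
      forall c, c != 0 -> sl2_conj P (c *: nil2 F) |
      exists2 c, c != 0 & sl2_conj P (c *: diag2 F)].
Proof.
move=> trP.
have n2 : 2%:R != 0 :> F by rewrite Num.Theory.pnatr_eq0.
(* As the trace is 0, the eigenvalues are [d] and [- d]. *)
pose d := Num.Theory.sqrtC (- \det P).
have d2 : d ^+ 2 = - \det P by rewrite Num.Theory.sqrtCK.
have /det0P [v v0] : \det (P + d%:M) == 0.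
  move: trP d2; rewrite [P]mx2_eta tr_mx2 det_mx2 => /eqP.
  rewrite addr_eq0 => /eqP-> d2.
  rewrite (_ : _ + _ = mx2 (- P 1 1 + d) (P 0 1) (P 1 0) (P 1 1 + d)).
    by rewrite det_mx2; apply/eqP; ring: d2.
  apply/matrixP => i j; rewrite !mxE.
  by case: (ord2P i) => ->; case: (ord2P j) => ->; rewrite /= ?addr0.
rewrite mulmxDr mul_mx_scalar => /eqP; rewrite addr_eq0 => /eqP vP.
have [a [b ab]] := unimodular_row v0.
(* The last row of the change of basis is the left eigenvector [v], so the
   conjugate of [P] is upper triangular. *)
have [e Pe] : exists e, sl2_conj P (mx2 d e 0 (- d)).
  (* The upper right entry of [g *m P *m invmx g], where [g] has rows [(a, b)] and [v]. *)
  exists ((a * P 0 1 + b * P 1 1) * a - (a * P 0 0 + b * P 1 0) * b).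
  exists (mx2 a b (v 0 0) (v 0 1)); first by rewrite det_mx2.
  have v0P := congr1 (fun w : 'rV_2 => w 0 0) vP.
  have v1P := congr1 (fun w : 'rV_2 => w 0 1) vP.
  move: v0P v1P trP; rewrite [P]mx2_eta tr_mx2 !mxE !big_ord_recl !big_ord0 /=.
  rewrite !addr0 (_ : lift 0 0 = 1); last exact: val_inj.
  rewrite !mxE /=; set x := v 0 0 in ab *; set y := v 0 1 in ab *.
  move: (P 0 0) (P 0 1) (P 1 0) (P 1 1) => p q r s xP yP trP.
  (* The right-hand side is the upper left entry of the conjugate; it is [d] because the lower right
     one is [- d] and the trace is 0. *)
  have dE : d = (a * p + b * r) * y - (a * q + b * s) * x.
    transitivity (d * (a * y - b * x)); first by rewrite ab mulr1.
    transitivity (b * - (d * x) - a * - (d * y) + (p + s) * (a * y - b * x)).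
      by rewrite trP; ring.
    by rewrite -xP -yP; ring.
  rewrite !mul_mx2; congr mx2; last 2 first.
  - by rewrite xP; ring.
  - by rewrite yP; ring.
  - rewrite {}dE; transitivity ((a * p + b * r) * (a * y - b * x)).
      by rewrite ab mulr1.
    by ring.
  rewrite {}dE; transitivity ((a * q + b * s) * (a * y - b * x)).
    by rewrite ab mulr1.
  by ring.
have [dz|dnz] := eqVneq d 0; last first.
  apply: Or33; exists d => //; apply: sl2_conj_trans Pe _.
  (* A unipotent change of basis clears [e]; [2%:R * d] is the difference of the eigenvalues. *)
  exists (mx2 1 (e / (2%:R * d)) 0 1); first by rewrite det_mx2; ring.
  by rewrite scale_mx2 !mul_mx2; congr mx2; field; rewrite ?dnz ?n2.
rewrite dz oppr0 in Pe; have [ez|enz] := eqVneq e 0.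
  by apply: Or31; apply/eqP; rewrite (sl2_conj_eq0 Pe) ez mx2_eq0 eqxx.
apply: Or32 => c cnz; apply: sl2_conj_trans Pe _.
(* Conjugation by diag(t, 1/t) multiplies the upper right entry by [t ^+ 2]. *)
pose t := Num.Theory.sqrtC (c / e).
have t2 : t ^+ 2 = c / e by rewrite Num.Theory.sqrtCK.
have tnz : t != 0 by rewrite -sqrf_eq0 t2 mulf_neq0 ?invr_eq0.
exists (mx2 t 0 0 t^-1); first by rewrite det_mx2 mulfV // mulr0 subr0.
rewrite scale_mx2 !mul_mx2; congr mx2; rewrite ?(mulr0, mul0r, addr0, add0r) //.
by rewrite mulr1; apply: (mulIf tnz); rewrite mulrAC -expr2 t2 divfK // divfK.
Qed.

(** * Lines of block diagonal matrices and their equivalence *)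

Section Blocks.
Variable F : fieldType.

Definition block2 (P Q : 'M[F]_2) : 'M[F]_4 :=
  (block_mx P 0 0 Q : 'M[F]_(2 + 2)).

Lemma mul_block2 P Q P' Q' :
  block2 P Q *m block2 P' Q' = block2 (P *m P') (Q *m Q').
Proof.
apply: etrans (@mulmx_block F 2 2 2 2 2 2 P 0 0 Q P' 0 0 Q') _.
by rewrite !mulmx0 !mul0mx !addr0 add0r.
Qed.

Lemma scale_block2 c P Q : c *: block2 P Q = block2 (c *: P) (c *: Q).
Proof.
by apply: etrans (@scale_block_mx F 2 2 2 2 c P 0 0 Q) _; rewrite !scaler0.
Qed.

Lemma block2_inj P Q P' Q' : block2 P Q = block2 P' Q' -> P = P' /\ Q = Q'.
Proof. by move=> /(@eq_block_mx _ 2 2 2 2) []. Qed.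

Lemma block2_eq0 P Q : (block2 P Q == 0) = (P == 0) && (Q == 0).
Proof.
have block00 : block2 0 0 = 0 by rewrite /block2 block_mx0.
apply/eqP/andP => [|[/eqP-> /eqP->] //].
by rewrite -block00 => /block2_inj[-> ->].
Qed.

Lemma det_block2 P Q : \det (block2 P Q) = \det P * \det Q.
Proof. exact: (@det_ublock _ 2 2). Qed.

Lemma vline_eq (V : vectType F) (u v : V) :
  <[u]>%VS = <[v]>%VS <-> exists2 c, c != 0 & u = c *: v.
Proof.
split=> [uv|[c c0 ->]]; last first.
  apply/eqP; rewrite eqEsubv -!memvE memvZ ?memv_line //=.
  by apply/vlineP; exists c^-1; rewrite scalerA mulVf // scale1r.
have /vlineP [c uE] : u \in <[v]>%VS by rewrite -uv memv_line.
have [c0|] := eqVneq c 0; last by exists c.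
(* Here [u] and [v] both vanish, so any nonzero scalar would do. *)
exists 1; first exact: oner_neq0.
have /vlineP [k] : v \in <[u]>%VS by rewrite uv memv_line.
by rewrite uE c0 scale0r scaler0 => ->; rewrite scaler0.
Qed.

(** The group acts on each block separately, while a change of generator rescales both blocks by the
    same [c]. *)
Lemma inner_equiv_block2 P Q P' Q' :
  inner_equiv <[block2 P Q]>%VS <[block2 P' Q']>%VS <->
  exists c, [/\ c != 0, sl2_conj P (c *: P') & sl2_conj Q (c *: Q')].
Proof.
split=> [[A [g [k [AE detg detk]]]]|[c [c0 [g detg gP] [k detk kQ]]]].
  have uA : A \in unitmx.
    by rewrite unitmxE AE det_block2 detg detk mulr1 unitr1.
  rewrite limg_line lfunE => /vline_eq[c c0 /(congr1 (mulmxr A))].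
  rewrite /= /inner_aut mulmxKV // AE scale_block2 !mul_block2.
  by move=> /block2_inj[gP kQ]; exists c; split=> //; [exists g | exists k].
have uA : block2 g k \in unitmx.
  by rewrite unitmxE det_block2 detg detk mulr1 unitr1.
exists (block2 g k); first by exists g, k.
rewrite limg_line lfunE; apply/vline_eq; exists c => //=.
by rewrite /inner_aut mul_block2 gP kQ -mul_block2 -scale_block2 mulmxK.
Qed.

Definition upper_block (l : label F) : 'M[F]_2 :=
  match l with
  | L1 | L5 | L6 => nil2 F
  | L2 | L4 => 0
  | L3 | L7 | L8 _ => diag2 F
  end.

Definition lower_block (l : label F) : 'M[F]_2 :=
  match l with
  | L1 | L3 => 0
  | L2 | L5 | L7 => nil2 F
  | L4 | L6 => diag2 F
  | L8 a => a *: diag2 F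
  end.

Lemma J_block2 l : J l = <[block2 (upper_block l) (lower_block l)]>%VS.
Proof.
case: l => [||||||| a] /=; congr <[_]>%VS; apply/matrixP;
  do 2![case=> [[|[|[|[|//]]]] ?]];
  rewrite !mxE /split /=; case: ltnP => // ?;
  rewrite !mxE /split /=; case: ltnP => // ?;
  by rewrite !mxE /= ?(subr0, sub0r, addr0, add0r, mulr0, mulr1, oppr0).
Qed.

Lemma trace_blocks (l : label F) :
  \tr (upper_block l) = 0 /\ \tr (lower_block l) = 0.
Proof.
have tr_nil : \tr (nil2 F) = 0 by rewrite tr_mx2 addr0.
have tr_diag : \tr (diag2 F) = 0 by rewrite tr_mx2 subrr.
by case: l => [||||||| a]; rewrite /= ?mxtraceZ ?tr_diag ?mulr0 ?mxtrace0.
Qed.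

Lemma nil2_eq0 : (nil2 F == 0) = false.
Proof. by rewrite mx2_eq0 oner_eq0 andbF. Qed.

Lemma diag2_eq0 : (diag2 F == 0) = false.
Proof. by rewrite mx2_eq0 oner_eq0. Qed.

Lemma det_nil2 : \det (nil2 F) = 0.
Proof. by rewrite det_mx2; ring. Qed.

Lemma det_diag2 : \det (diag2 F) = -1.
Proof. by rewrite det_mx2; ring. Qed.

(** Multiples of a single matrix commute, so all brackets vanish. *)
Lemma so4_subalgebra_line P Q :
  \tr P = 0 -> \tr Q = 0 -> so4_subalgebra <[block2 P Q]>%VS.
Proof.
move=> trP trQ; split=> [X /vlineP[k ->]|X Y /vlineP[k ->] /vlineP[m ->]].
  exists (k *: P), (k *: Q).
  by rewrite scale_block2 !mxtraceZ trP trQ !mulr0.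
by rewrite /lie_bracket -!scalemxAl -!scalemxAr !scalerA mulrC subrr mem0v.
Qed.

Lemma J_subalgebra (l : label F) : so4_subalgebra (J l) /\ \dim (J l) = 1%N.
Proof.
have [trP trQ] := trace_blocks l; rewrite J_block2.
split; first exact: so4_subalgebra_line.
rewrite dim_vline block2_eq0.
by case: {trP trQ} l => [||||||| a]; rewrite /= ?nil2_eq0 ?diag2_eq0 ?andbF.
Qed.

(** For a traceless block, the two tests tell apart zero, nonzero nilpotent and invertible. *)
Definition zero_pattern (P Q : 'M[F]_2) :=
  (P == 0, \det P == 0, Q == 0, \det Q == 0).

Lemma zero_pattern_equiv P Q P' Q' :
  inner_equiv <[block2 P Q]>%VS <[block2 P' Q']>%VS ->
  zero_pattern P Q = zero_pattern P' Q'.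
Proof.
move=> /inner_equiv_block2[c [c0 PP' QQ']]; rewrite /zero_pattern.
rewrite (sl2_conj_eq0 PP') (sl2_conj_eq0 QQ') (sl2_conj_det PP').
rewrite (sl2_conj_det QQ') !detZ !scaler_eq0 !mulf_eq0.
by rewrite !(negPf c0).
Qed.

Lemma inner_equiv_L8 (a b : F) :
  inner_equiv (J (L8 a)) (J (L8 b)) <-> a = b \/ a = - b.
Proof.
rewrite !J_block2 inner_equiv_block2 /=; split=> [[c [c0 DD abD]]|ab]; last first.
  exists 1; rewrite oner_eq0 !scale1r; split=> //; first exact: sl2_conj_refl.
  case: ab => ->; first exact: sl2_conj_refl.
  by rewrite -{2}[b]opprK; apply: sl2_conj_diagN.
(* The upper blocks force [c ^+ 2 = 1]; the lower ones then give [a ^+ 2 = b ^+ 2]. *)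
have := sl2_conj_det DD; rewrite detZ det_diag2 mulrN1 => /oppr_inj c2.
have := sl2_conj_det abD; rewrite !detZ det_diag2 -c2 mul1r !mulrN1.
by move=> /oppr_inj/eqP; rewrite eqf_sqr => /orP[]/eqP; [left | right].
Qed.

Lemma inner_equiv_J_distinct (l l' : label F) :
  admissible l -> admissible l' -> l <> l' -> inner_equiv (J l) (J l') ->
  exists a, l = L8 a /\ l' = L8 (- a).
Proof.
move=> adm adm' ll' equiv.
have := equiv; rewrite !J_block2 => /zero_pattern_equiv.
(* Distinct constructors have distinct zero patterns, so only two members of the eighth family
   remain. *)
case: l l' adm adm' ll' equiv => [||||||| a] [||||||| b] //= adm adm' ll' equiv;
  rewrite /zero_pattern ?detZ ?det0 ?det_nil2 ?det_diag2 ?scaler_eq0 ?mulf_eq0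
    ?expf_eq0 ?(negPf adm) ?(negPf adm') /= ?eqxx ?nil2_eq0 ?diag2_eq0
    ?oppr_eq0 ?oner_eq0 // => _.
exists a; split=> //; congr L8.
by case/inner_equiv_L8: equiv ll' => [->|->]; rewrite ?opprK.
Qed.

End Blocks.

Lemma so4_line_classification (F : numClosedFieldType) (S : {vspace 'M[F]_4}) :
  so4_subalgebra S -> \dim S = 1%N ->
  exists2 l : label F, admissible l & inner_equiv S (J l).
Proof.
move=> [so4S _] dimS.
have pS0 : vpick S != 0 by rewrite vpick0 -dimv_eq0 dimS.
have [P [Q [XE trP trQ]]] := so4S _ (memv_pick S).
have SE : S = <[block2 P Q]>%VS.
  apply/esym/eqP; rewrite eqEdim dim_vline -[block2 P Q]XE pS0 dimS leqnn.
  by rewrite andbT -memvE memv_pick.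
have : block2 P Q != 0 by rewrite -[block2 P Q]XE.
rewrite block2_eq0 {}SE {so4S dimS pS0 XE S}.
have equivJ l c : c != 0 -> admissible l -> sl2_conj P (c *: upper_block l) ->
    sl2_conj Q (c *: lower_block l) ->
    exists2 l : label F, admissible l & inner_equiv <[block2 P Q]>%VS (J l).
  move=> c0 adm cP cQ; exists l => //.
  by rewrite J_block2; apply/inner_equiv_block2; exists c.
have conj0 c : sl2_conj 0 (c *: 0 : 'M[F]_2).
  by rewrite scaler0; apply: sl2_conj_refl.
(* In the nine cases below, a semisimple block dictates the common scalar and a nilpotent or zero
   block adapts to it. *)
have one0 := oner_neq0 F.
have [P0|nilP|[c c0 cP]] := sl2_normal_form trP;
  have [Q0|nilQ|[d d0 dQ]] := sl2_normal_form trQ.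
- by rewrite P0 Q0 eqxx.
- by move=> _; apply: (equivJ L2 1); rewrite /= ?P0 //; apply: nilQ.
- by move=> _; apply: (equivJ L4 d); rewrite /= ?P0.
- by move=> _; apply: (equivJ L1 1); rewrite /= ?Q0 //; apply: nilP.
- by move=> _; apply: (equivJ L5 1); rewrite //=; [apply: nilP | apply: nilQ].
- by move=> _; apply: (equivJ L6 d); rewrite //=; apply: nilP.
- by move=> _; apply: (equivJ L3 c); rewrite /= ?Q0.
- by move=> _; apply: (equivJ L7 c); rewrite //=; apply: nilQ.
(* With both blocks semisimple, factoring [c] out of the generator leaves the ratio [d / c] as
   parameter. *)
move=> _; apply: (equivJ (L8 (d / c)) c) => //=.
  by rewrite mulf_neq0 ?invr_eq0.
by rewrite scalerA mulrC divfK.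
Qed.

Theorem theorem5p1 (R : realType) :
  [/\ (* the listed subspaces are 1-dimensional subalgebras *)
      forall l : label R[i], admissible l ->
        so4_subalgebra (J l) /\ \dim (J l) = 1%N,
      (* the list is exhaustive up to inner automorphism *)
      forall S : {vspace 'M[R[i]]_4}, so4_subalgebra S -> \dim S = 1%N ->
        exists2 l : label R[i], admissible l & inner_equiv S (J l),
      (* equivalences inside the eighth family *)
      forall a b : R[i], a != 0 -> b != 0 ->
        (inner_equiv (J (L8 a)) (J (L8 b)) <-> a = b \/ a = - b)
    & (* there are no other equivalences between distinct members *)
      forall l l' : label R[i], admissible l -> admissible l' -> l <> l' ->
        inner_equiv (J l) (J l') ->
        exists a : R[i], l = L8 a /\ l' = L8 (- a)].
Proof.
split.
- by move=> l _; apply: J_subalgebra.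
- exact: so4_line_classification.
- by move=> a b _ _; apply: inner_equiv_L8.
- exact: inner_equiv_J_distinct.
Qed.
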